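(* Let $r,s$ be integers with $r\ge s\ge 3$, $s\ne 4$, and $r\ge 6$. Then $\mathrm{gp}(C_r\,\square\,C_s)\in\{6,7\}$.
   Context: For a connected graph $G$ with shortest-path distance $d_G$, a set $S\subseteq V(G)$ is a general position set if $d_G(u,v)\ne d_G(u,w)+d_G(w,v)$ holds for every choice of three distinct vertices $u,v,w\in S$ (in every role assignment), i.e. no three distinct vertices of $S$ lie on a common geodesic. The general position number $\mathrm{gp}(G)$ is the maximum cardinality of a general position set of $G$. $C_n$ is the cycle on $n$ vertices. The Cartesian product $G\,\square\,H$ has vertex set $V(G)\times V(H)$, with $(g,h)$ and $(g',h')$ adjacent if either $gg'\in E(G)$ and $h=h'$, or $g=g'$ and $hh'\in E(H)$. *)

(* Defs.v *)
From mathcomp Require Import all_boot.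

Set Implicit Arguments.
Unset Strict Implicit.
Unset Printing Implicit Defensive.

(* A finite simple graph is given by its adjacency relation, a symmetric and  *)
(* irreflexive e : rel T on the finType T of vertices.                        *)

Section GeneralPosition.
Variables (T : finType) (e : rel T).

Definition has_walk (n : nat) (x y : T) : bool :=
  [exists p : n.-tuple T, path e x p && (last x p == y)].

(* The least length of a walk from x to y. A shortest walk has distinct       *)
(* vertices, so its length is below #|T|; the junk value #|T| is taken        *)
(* exactly when x and y are not connected.                                    *)
Definition gdist (x y : T) : nat :=
  find (fun n => has_walk n x y) (iota 0 #|T|).

Definition general_position (S : {set T}) : bool :=
  [forall u in S, forall v in S, forall w in S,
     [&& u != v, u != w & v != w] ==> (gdist u v != gdist u w + gdist w v)].

Definition gp_number : nat :=
  \max_(S : {set T} | general_position S) #|S|.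

End GeneralPosition.

(* ordS is the successor modulo n, so this is the simple graph C_n for every  *)
(* n >= 3 (for n = 1 the relation has a loop).                                *)
Definition cycle_graph (n : nat) : rel 'I_n :=
  [rel i j | (j == ordS i) || (i == ordS j)].

Definition cartesian_product (T U : finType) (e : rel T) (f : rel U) :
    rel (T * U) :=
  [rel x y | e x.1 y.1 && (x.2 == y.2) || (x.1 == y.1) && f x.2 y.2].

(* Main.v *)
Require Import Defs.
From mathcomp Require Import all_boot.
From mathcomp Require Import zify.

(** The distance in C_r [] C_s is the sum of the two cyclic distances
    ([gdist_torus]), so a vertex lies on a geodesic between two others exactly
    when this holds in both coordinates.

    Six is attained by explicit sets. Their coordinates are chosen so that every
    cyclic distance is linear in the half-lengths of the cycles, and general
    position becomes a list of linear disequalities.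

    For the upper bound, take eight points. Move them slightly on the two circles
    so that no two have equal or antipodal coordinates. This can only destroy
    betweenness, since being on a common shortest arc is a closed condition. Now
    each coordinate orients every pair of points: q is ahead of p when the short
    arc from p to q runs in the positive direction. If p -> m -> q and p -> q in
    the first coordinate, and the second coordinate orients these three pairs
    either all in the same way or all oppositely, then m is on a geodesic between
    p and q ([between_cdist]). So colour a pair by whether the two coordinates
    agree on it: a monochromatic triangle that is transitive in the first
    coordinate is a violation of general position ([violation_aligned]).

    Replacing a point of a circle by its antipode reverses all its arrows. Hence
    the orientation given by a coordinate is determined by the linear order of the
    points modulo half a turn, together with one bit per point for the half-circle
    where the point lies. Eight points on the torus thus amount to a permutation
    (the second order read along the first) and two bits per point. There are
    finitely many of these, and a search that inserts the points one at a time,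
    dropping a configuration at its first violation, finds none of length eight
    without a violation ([violation_among_eight]). *)

Set Implicit Arguments.
Unset Strict Implicit.
Unset Printing Implicit Defensive.

Local Notation torus r s :=
  (cartesian_product (@cycle_graph r) (@cycle_graph s)).

(** * Distances in cycles and tori *)

(** A function is the graph distance as soon as it vanishes exactly on the
    diagonal, drops by at most one along an edge (so no walk is shorter), and
    drops by one along some edge (so following it is a walk of that length). *)
Lemma gdistE (T : finType) (e : rel T) (d : T -> T -> nat) :
  (forall x y, d x y = 0 <-> x = y) ->
  (forall x y z, e x z -> d x y <= (d z y).+1) ->
  (forall x y, 0 < d x y -> exists2 z, e x z & d x y = (d z y).+1) ->
  (forall x y, d x y < #|T|) ->
  forall x y, gdist e x y = d x y.
Proof.
move=> d0 dle dstep dlt x y.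
have walkP n : reflect (exists p, [/\ size p = n, path e x p & last x p = y])
                       (has_walk e n x y).
  apply: (iffP existsP) => [[p /andP[ep /eqP lp]]|[p [sp ep lp]]].
    by exists p; rewrite size_tuple.
  by exists (Tuple (introT eqP sp)); rewrite ep /= lp.
have short p : path e x p -> last x p = y -> d x y <= size p.
  elim: p x {walkP} => [|z p IHp] x /=; first by move=> _ /d0 ->.
  by move=> /andP[exz /IHp ep] /ep; have := dle x y z exz; lia.
have walk_d : has_walk e (d x y) x y.
  apply/walkP; move Dn: (d x y) => n.
  elim: n x {walkP short} Dn => [|n IHn] x Dn.
    by exists [::]; split=> //; apply/d0.
  have [|z euz] := dstep x y; first by rewrite Dn.
  rewrite Dn => -[] /esym/IHn[p [sp ep lp]].
  by exists (z :: p); rewrite /= sp euz ep lp.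
rewrite /gdist; set w := (X in find X _).
have hasw : has w (iota 0 #|T|).
  by apply/hasP; exists (d x y); rewrite ?mem_iota ?dlt.
apply/eqP; rewrite eqn_leq; apply/andP; split; last first.
  have := nth_find 0 hasw.
  rewrite nth_iota; last by rewrite has_find size_iota in hasw.
  by rewrite add0n => /walkP[p [<- ep lp]]; apply: short.
rewrite leqNgt; apply/negP => /(before_find 0).
by rewrite nth_iota // add0n /w walk_d.
Qed.

Definition cdist (n i j : nat) : nat :=
  minn ((i - j) + (j - i)) (n - ((i - j) + (j - i))).

Lemma cdistC n i j : cdist n i j = cdist n j i.
Proof. by rewrite /cdist addnC. Qed.

Lemma cdist_eq0 n (i j : 'I_n) : cdist n i j = 0 <-> i = j.
Proof.
have := (ltn_ord i, ltn_ord j); rewrite /cdist => -[? ?].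
split=> [?|->]; first apply: val_inj => /=; lia.
Qed.

Lemma cycle_graphP n (i j : 'I_n) : cycle_graph i j ->
  [\/ j = i.+1 :> nat, i = j.+1 :> nat, i = 0 :> nat /\ j = n.-1 :> nat
    | j = 0 :> nat /\ i = n.-1 :> nat].
Proof.
have wrap (k l : 'I_n) : k == ordS l ->
    k = l.+1 :> nat \/ k = 0 :> nat /\ l = n.-1 :> nat.
  move=> /eqP->; rewrite /ordS /=; have := ltn_ord l.
  rewrite leq_eqVlt => /predU1P[eqn|/modn_small->]; last by left.
  by right; rewrite eqn modnn; lia.
case/orP=> /wrap; first by case=> [?|[? ?]]; [constructor 1 | constructor 4].
by case=> [?|[? ?]]; [constructor 2 | constructor 3].
Qed.

Lemma cdist_lip n (i j k : 'I_n) :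
  cycle_graph i k -> cdist n i j <= (cdist n k j).+1.
Proof.
move=> /cycle_graphP; have := (ltn_ord i, ltn_ord j, ltn_ord k).
rewrite /cdist; case=> [[]]; case: i => i /= _; case: j k => j /= _ [k /= _].
by move=> ? ? ? [] *; lia.
Qed.

Lemma cdist_step n (i j : 'I_n) : 0 < cdist n i j ->
  exists2 k, cycle_graph i k & cdist n i j = (cdist n k j).+1.
Proof.
move=> dij; have [i_n j_n] := (ltn_ord i, ltn_ord j).
(* Step towards j along a shorter arc: up in the first case, else down. *)
have [fwd|bwd] : (i < j /\ 2 * (j - i) <= n \/ j < i /\ n <= 2 * (i - j)) \/
                 (i < j /\ n <= 2 * (j - i) \/ j < i /\ 2 * (i - j) <= n).
  by move: dij; rewrite /cdist; lia.
- exists (ordS i); first by rewrite /cycle_graph /= eqxx.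
  move: dij fwd; rewrite /cdist /=.
  have [eqn|lt_n] : i.+1 = n \/ i.+1 < n by lia.
    by rewrite eqn modnn; lia.
  by rewrite modn_small //; lia.
- have eqi : ordS (ord_pred i) = i by apply: ord_predK.
  exists (ord_pred i); first by rewrite /cycle_graph /= eqi eqxx orbT.
  move: (congr1 val eqi) (ltn_ord (ord_pred i)); rewrite /=.
  move: ((i + n).-1 %% n) => k eqk; rewrite leq_eqVlt => /predU1P[eqn|lt_n].
    by move: eqk dij bwd; rewrite eqn modnn /cdist; lia.
  by move: eqk dij bwd; rewrite modn_small // /cdist; lia.
Qed.

Lemma gdist_torus r s (u v : 'I_r * 'I_s) : 2 < r -> 2 < s ->
  gdist (torus r s) u v = cdist r u.1 v.1 + cdist s u.2 v.2.
Proof.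
move=> r3 s3; pose d (x y : 'I_r * 'I_s) := cdist r x.1 y.1 + cdist s x.2 y.2.
apply: (gdistE (d := d)); rewrite /d.
- move=> [a b] [c c'] /=; split=> [/eqP|[-> ->]]; last first.
    by rewrite (iffRL (cdist_eq0 _ _)) // (iffRL (cdist_eq0 _ _)).
  by rewrite addn_eq0 => /andP[/eqP/cdist_eq0-> /eqP/cdist_eq0->].
- move=> [a b] [c c'] [a' b'] /orP[]/andP[] /=.
    by move=> /(@cdist_lip _ _ c)=> ? /eqP->; lia.
  by move=> /eqP-> /(@cdist_lip _ _ c') ?; lia.
- move=> [a b] [c c'] /=; rewrite addn_gt0 => /orP[] /cdist_step[k ek dk].
    by exists (k, b); [apply/orP; left; rewrite ek /= | rewrite /= dk].
  by exists (a, k); [apply/orP; right; rewrite ek eqxx | rewrite /= dk addnS].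
- move=> x y; rewrite card_prod !card_ord /cdist.
  have := (ltn_ord x.1, ltn_ord y.1, ltn_ord x.2, ltn_ord y.2).
  case=> [[[]]]; nia.
Qed.

(** * Six points in general position *)

Section GeneralSequences.
Variables (T : eqType) (d : T -> T -> nat).
Hypothesis dC : forall x y, d x y = d y x.

Definition not_collinear x y z :=
  [&& d x z != d x y + d y z, d x y != d x z + d y z & d y z != d x y + d x z].

(** Each triple is tested once, in the order of the sequence, and each distance
    is written from the earlier to the later point: on a concrete sequence this
    unfolds to conditions on the upper half of the distance matrix. *)
Fixpoint general_seq (s : seq T) :=
  if s is x :: s' then pairwise (not_collinear x) s' && general_seq s' else true.

Lemma not_collinearC x y z : not_collinear x y z = not_collinear x z y.
Proof. rewrite /not_collinear (dC z y); lia. Qed.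

Lemma not_collinearCA x y z : not_collinear x y z = not_collinear y x z.
Proof. rewrite /not_collinear (dC y x); lia. Qed.

Lemma general_seqP s : general_seq s ->
  {in s & &, forall x y z, x != y -> x != z -> y != z ->
     d x y != d x z + d z y}.
Proof.
suff gs : general_seq s ->
    {in s & &, forall x y z, x != y -> x != z -> y != z -> not_collinear x y z}.
  move=> /gs gen x y z xs ys zs xy xz yz; rewrite (dC z y).
  by case/and3P: (gen x y z xs ys zs xy xz yz).
elim: s => [|a s IHs] //= /andP[gen_a /IHs{}IHs].
have {}gen_a x y : x \in s -> y \in s -> x != y -> not_collinear a x y.
  have: pairwise (fun x y => (x == y) || not_collinear a x y) s.
    by apply: sub_pairwise gen_a => ? ? ->; rewrite orbT.
  rewrite pairwise_all2rel; first 1 last; first by move=> ?; rewrite eqxx.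
  - by move=> ? ?; rewrite eq_sym not_collinearC.
  by move=> /allrelP gen xs ys /negPf xy; have := gen x y xs ys; rewrite xy.
move=> x y z; rewrite !inE => /predU1P[->|xs] /predU1P[->|ys] /predU1P[->|zs];
  rewrite ?eqxx // => xy xz yz; last exact: IHs.
- exact: gen_a.
- by rewrite not_collinearCA gen_a.
- by rewrite not_collinearC not_collinearCA gen_a.
Qed.

End GeneralSequences.

Definition torus_dist (r s : nat) (p q : nat * nat) : nat :=
  cdist r p.1 q.1 + cdist s p.2 q.2.

Lemma size_le_gp_torus r s (ps : seq (nat * nat)) : 2 < r -> 2 < s ->
  uniq ps -> {in ps, forall p, p.1 < r /\ p.2 < s} ->
  general_seq (torus_dist r s) ps ->
  size ps <= gp_number (torus r s).
Proof.
move=> r3 s3 ps_uniq ps_lt.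
have dC p q : torus_dist r s p q = torus_dist r s q p.
  by rewrite /torus_dist cdistC [cdist s _ _]cdistC.
move=> /(general_seqP dC) ps_gp.
pose code (z : 'I_r * 'I_s) := (val z.1, val z.2).
have code_inj : injective code by move=> [a b] [c d] [/val_inj-> /val_inj->].
pose S := [set z | code z \in ps].
have <- : #|S| = size ps.
  rewrite cardE -(size_map code); apply/perm_size/uniq_perm => //.
    by rewrite map_inj_uniq ?enum_uniq.
  move=> p; apply/mapP/idP => [[z]|p_ps].
    by rewrite mem_enum inE => zS ->.
  have [p1 p2] := ps_lt p p_ps.
  exists (Ordinal p1, Ordinal p2); last by rewrite /code -surjective_pairing.
  by rewrite mem_enum inE /code /= -surjective_pairing.
apply: leq_bigmax_cond; apply/'forall_implyP => u uS.
apply/'forall_implyP => v vS; apply/'forall_implyP => w wS.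
apply/implyP => /and3P[uv uw vw]; rewrite !gdist_torus //.
rewrite !inE in uS vS wS.
by apply: (ps_gp _ _ _ uS vS wS); rewrite (inj_eq code_inj).
Qed.

Lemma half_parityE n : exists h t, t <= 1 /\ n = h + h + t.
Proof.
by exists n./2, (odd n); rewrite addnn addnC odd_double_half leq_b1.
Qed.

(** The columns used by both families of six points. The table evaluates the
    minima of [cdist] once and for all, so that afterwards linear arithmetic
    has no case distinctions to make; the same holds for [row_dists]. *)
Lemma column_dists h t : t <= 1 -> 3 <= h -> let r := h + h + t in
  (cdist r 0 1 = 1) * (cdist r 0 2 = 2) * (cdist r 0 h = h) *
  (cdist r 0 h.+1 = h + t - 1) * (cdist r 0 r.-1 = 1) * (cdist r 1 2 = 1) *
  (cdist r 1 h = h - 1) * (cdist r 1 h.+1 = h) * (cdist r 1 r.-1 = 2) *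
  (cdist r 2 h = h - 2) * (cdist r 2 h.+1 = h - 1) * (cdist r 2 r.-1 = 3) *
  (cdist r h h.+1 = 1) * (cdist r h r.-1 = h + t - 1) *
  (cdist r h.+1 r.-1 = h + t - 2).
Proof.
by move=> t1 h3 r; rewrite /r /cdist; repeat apply: pair; lia.
Qed.

Lemma row_dists g t : t <= 1 -> 2 <= g -> 5 <= g + g + t ->
  let s := g + g + t in
  (cdist s 0 1 = 1) * (cdist s 0 g.+1 = g + t - 1) * (cdist s 0 s.-1 = 1) *
  (cdist s 0 g.-1 = g - 1) * (cdist s 0 g = g) * (cdist s 1 g.+1 = g) *
  (cdist s 1 s.-1 = 2) * (cdist s 1 g.-1 = g - 2) * (cdist s 1 g = g - 1) *
  (cdist s g.+1 s.-1 = g + t - 2) * (cdist s g.+1 g.-1 = 2) *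
  (cdist s g.+1 g = 1) * (cdist s s.-1 g.-1 = g) *
  (cdist s s.-1 g = g + t - 1) * (cdist s g.-1 g = 1).
Proof.
by move=> t1 h3 s5 s; rewrite /s /cdist; repeat apply: pair; lia.
Qed.

Lemma six_le_gp_torus r s : 6 <= r -> 5 <= s -> 6 <= gp_number (torus r s).
Proof.
have [h [t [t1 ->]]] := half_parityE r => {r}r6.
have [g [t' [t'1 ->]]] := half_parityE s => {s}s5.
have h3 : 3 <= h by lia.
have g2 : 2 <= g by lia.
have dx := column_dists t1 h3; have dy := row_dists t'1 g2 s5.
apply: (@size_le_gp_torus _ _
  [:: (0, 0); (1, 1); (2, g.+1); (h, (g + g + t').-1); (h.+1, g.-1);
      ((h + h + t).-1, g)]) => //; [lia | lia | | |].
- by rewrite /= !inE !xpair_eqE; lia.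
- by move=> p; rewrite !inE => /or4P[|||/or3P[]] /eqP->; split=> //=; lia.
rewrite /general_seq /= /not_collinear /torus_dist /= !dx !dy.
by repeat (apply/andP; split); lia.
Qed.

(** For s = 3 the rows s - 1 and floor(s/2) + 1 of the previous family coincide,
    which puts (2, 2) on a geodesic from (1, 1) to (h, 2); the last three points
    are moved to other rows. *)
Lemma six_le_gp_torus3 r : 6 <= r -> 6 <= gp_number (torus r 3).
Proof.
have [h [t [t1 ->]]] := half_parityE r => {r}r6.
have h3 : 3 <= h by lia.
have dx := column_dists t1 h3.
apply: (@size_le_gp_torus _ 3
  [:: (0, 0); (1, 1); (2, 2); (h, 0); (h.+1, 1); ((h + h + t).-1, 2)]) => //.
- lia.
- by rewrite /= !inE !xpair_eqE; lia.
- by move=> p; rewrite !inE => /or4P[|||/or3P[]] /eqP->; split=> //=; lia.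
rewrite /general_seq /= /not_collinear /torus_dist /= !dx /cdist.
by repeat (apply/andP; split); lia.
Qed.

(** * Signed positions on a cycle *)

(** Twice the position, modulo [n]: doubling keeps the position modulo half a
    turn an integer when [n] is odd. *)
Definition half n x := if 2 * x < n then 2 * x else 2 * x - n.

Definition far n x := n <= 2 * x.

(** The [i]-th of at most eight points, moved forward by [i] sixteenths of an
    edge, in units of one sixteenth and modulo half a turn, with the bit telling
    in which half-turn it is. Since 0 <= i < 8, two points with distinct indices
    are neither equal nor antipodal. *)
Definition spos n x i : nat * bool := (8 * half n x + i, far n x).

(** The short arc from [p] to [q] is positive: moving a point by half a turn
    reverses its arrows, so the comparison modulo half a turn is flipped exactly
    when the two points are in different half-turns. *)
Definition ahead (p q : nat * bool) := (p.1 < q.1) == (p.2 == q.2).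

Definition between (p m q : nat * bool) :=
  [&& ahead p m, ahead m q & ahead p q] ||
  [&& ahead q m, ahead m p & ahead q p].

Lemma ahead_sym p q : p.1 != q.1 -> ahead q p = ~~ ahead p q.
Proof.
rewrite /ahead [q.2 == _]eq_sym.
by case: ltngtP => // _ _; case: (p.2 == q.2).
Qed.

Lemma spos_inj n x y i j :
  i < 8 -> j < 8 -> (spos n x i).1 = (spos n y j).1 -> i = j.
Proof. rewrite /=; lia. Qed.

Lemma halfE n x : x < n -> half n x < n /\ 2 * x = half n x + far n x * n.
Proof.
rewrite /half /far => xn.
by case: (ltnP (2 * x) n) => ? /=; rewrite ?mul1n ?mul0n; lia.
Qed.

(** The second condition says that the arc between the moved points, of length
    16 d + j - i sixteenths, is shorter than half a turn. *)
Lemma ahead_arc n x y i j : x < n -> y < n -> i < 8 -> j < 8 -> i != j ->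
  ahead (spos n x i) (spos n y j) ->
  exists2 d, 2 * d <= n /\ (y = x + d \/ y + n = x + d) &
             i <= j + 16 * d < 8 * n + i.
Proof.
move=> /halfE[xn xE] /halfE[yn yE] i8 j8 ij; rewrite /ahead /=.
move: xn xE yn yE; case: (far n x); case: (far n y) => /=;
  rewrite ?mul1n ?mul0n => xn xE yn yE; rewrite ?eqb_id ?eqbF_neg => lt_ij.
- exists (y - x); lia.
- exists (y + n - x); lia.
- exists (y - x); lia.
- exists (y - x); lia.
Qed.

Lemma arc_cdist n x y d : x < n -> y < n -> 2 * d <= n ->
  (y = x + d \/ y + n = x + d) -> cdist n x y = d.
Proof. rewrite /cdist => ? ? ? []; lia. Qed.

Lemma ahead_cdist n x y z i j k :
  x < n -> y < n -> z < n -> i < 8 -> j < 8 -> k < 8 ->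
  i != j -> i != k -> j != k ->
  ahead (spos n x i) (spos n y j) -> ahead (spos n y j) (spos n z k) ->
  ahead (spos n x i) (spos n z k) ->
  cdist n x z = cdist n x y + cdist n y z.
Proof.
move=> xn yn zn i8 j8 k8 ij ik jk.
move=> /(ahead_arc xn yn i8 j8 ij)[a [a1 a2] a3].
move=> /(ahead_arc yn zn j8 k8 jk)[b [b1 b2] b3].
move=> /(ahead_arc xn zn i8 k8 ik)[c [c1 c2] c3].
rewrite (arc_cdist xn yn a1 a2) (arc_cdist yn zn b1 b2) (arc_cdist xn zn c1 c2).
(* The two moved arcs add up to the third modulo a full turn, hence exactly,
   as each is shorter than half a turn. *)
by case: a2 b2 c2 a3 b3 c3 =>
  [?|?] [?|?] [?|?] /andP[? ?] /andP[? ?] /andP[? ?]; lia.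
Qed.

Lemma between_cdist n x y z i j k :
  x < n -> y < n -> z < n -> i < 8 -> j < 8 -> k < 8 ->
  i != j -> i != k -> j != k ->
  between (spos n x i) (spos n y j) (spos n z k) ->
  cdist n x z = cdist n x y + cdist n y z.
Proof.
move=> xn yn zn i8 j8 k8 ij ik jk /orP[] /and3P[h1 h2 h3].
  exact: ahead_cdist h1 h2 h3.
rewrite (cdistC n x z) (cdistC n x y) (cdistC n y z) addnC.
by apply: ahead_cdist h1 h2 h3; rewrite // eq_sym.
Qed.

(** * Signed configurations *)

(** A point of a configuration listed in the order of the first coordinate modulo
    half a turn: its half-turn bit there, the exclusive or of its two half-turn
    bits, and its place in the second coordinate modulo half a turn. *)
Record spoint := SPoint { xside : bool; twist : bool; yrank : nat }.

(** For [q] listed before [p]: the coordinates orient the pair in the same way.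
    The arrow is [xside q == xside p] in the first coordinate, and in the second
    one it is the comparison of ranks flipped by the half-turn bits; only the
    twists remain in the exclusive or. *)
Definition agree q p := (yrank q < yrank p) (+) twist q (+) twist p.

(** For [q], [m], [p] listed in this order: the triangle is monochromatic for
    [agree] and transitive in the first coordinate, where the only cyclic
    patterns are those with alternating half-turn bits. The nested conditionals
    make evaluation stop at the first failing test. *)
Definition violation q m p :=
  if agree q p (+) agree m p then false else
  if agree q m (+) agree m p then false else
  if xside m (+) xside p then xside q == xside m else true.

(** Configurations are stored with the last point first. *)
Fixpoint no_violation p s :=
  if s is m :: s' then
    if has (fun q => violation q m p) s' then false else no_violation p s'
  else true.

Definition make_room (b : nat) p :=
  SPoint (xside p) (twist p) (yrank p + (b <= yrank p)).

(** Again a conditional instead of a conjunction, so that [P] is evaluated only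
    on the additions without violation. *)
Definition has_addition (P : pred (seq spoint)) (s : seq spoint) : bool :=
  has (fun b => let s' := map (make_room b) s in
       has (fun e => has (fun d =>
         let p := SPoint e d b in
         if no_violation p s' then P (p :: s') else false)
       [:: false; true]) [:: false; true]) (iota 0 (size s).+1).

Fixpoint extendable (m : nat) (s : seq spoint) : bool :=
  if m is m'.+1 then has_addition (extendable m') s else true.

Lemma has_additionP (P : pred (seq spoint)) s p
    (s' := map (make_room (yrank p)) s) :
  yrank p <= size s -> no_violation p s' -> P (p :: s') -> has_addition P s.
Proof.
rewrite {}/s'; case: p => e d b b_s free_p Pp.
apply/hasP; exists b; first by rewrite mem_iota.
apply/hasP; exists e; first by case: (e).
by apply/hasP; exists d; [case: (d) | rewrite /= free_p].
Qed.

(** The exhaustive search. A violation depends on the bits of each kind only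
    through comparisons between points, so flipping all of them changes nothing
    and the first point may be given both bits false. *)
Lemma not_extendable : extendable 7 [:: SPoint false false 0] = false.
Proof. by vm_compute. Qed.

Section Standardization.
Variables (p : nat -> spoint) (N : nat).
Hypothesis yrank_inj :
  forall i j, i < N -> j < N -> yrank (p i) = yrank (p j) -> i = j.
Hypothesis p_free :
  forall i j k, i < j -> j < k -> k < N -> ~~ violation (p i) (p j) (p k).

Definition rank n i := count (fun j => yrank (p j) < yrank (p i)) (iota 0 n).

(** The search only meets configurations whose ranks are 0, ..., n - 1 and whose
    first point has both bits false; this is the [i]-th point of the one
    equivalent to the first [n] points of [p]. *)
Definition std n i :=
  SPoint (xside (p 0) (+) xside (p i)) (twist (p 0) (+) twist (p i)) (rank n i).

Lemma rank_le n i j : yrank (p i) <= yrank (p j) -> rank n i <= rank n j.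
Proof. by move=> pij; apply: sub_count => k /= /leq_trans->. Qed.

Lemma rank_lt n i j :
  i < n -> (rank n i < rank n j) = (yrank (p i) < yrank (p j)).
Proof.
move=> i_n; apply/idP/idP => [|pij].
  by rewrite !ltnNge; apply/contra/rank_le.
(* i itself is counted in the rank of j only. *)
have i_iota : i \in iota 0 n by rewrite mem_iota.
rewrite /rank !(permP (perm_to_rem i_iota)) /= ltnn pij add0n add1n ltnS.
by apply: sub_count => k /= /ltn_trans->.
Qed.

Lemma std_agree n i j : i < n -> agree (std n i) (std n j) = agree (p i) (p j).
Proof.
move=> i_n; rewrite /agree /= rank_lt //.
by case: (twist (p 0)); case: (twist (p i)); case: (twist (p j));
  case: (_ < _).
Qed.

Lemma std_violation n i j k : i < n -> j < n ->
  violation (std n i) (std n j) (std n k) = violation (p i) (p j) (p k).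
Proof.
move=> i_n j_n; rewrite /violation !std_agree //=.
by case: (xside (p 0)); case: (xside (p i)); case: (xside (p j));
  case: (xside (p k)).
Qed.

Lemma make_room_std n i : n < N -> i < n ->
  make_room (rank n.+1 n) (std n i) = std n.+1 i.
Proof.
move=> n_N i_n.
have rankS j : rank n.+1 j = rank n j + (yrank (p n) < yrank (p j)).
  by rewrite /rank -addn1 iotaD count_cat /= addn0.
rewrite /make_room /std !rankS ltnn addn0.
congr (SPoint _ _ (_ + nat_of_bool _)).
have ne_ni : yrank (p n) != yrank (p i) by apply/eqP => /yrank_inj; lia.
by rewrite leqNgt rank_lt // -leqNgt leq_eqVlt (negPf ne_ni).
Qed.

Lemma extendable_std n m :
  n + m <= N -> extendable m [seq std n i | i <- rev (iota 0 n)].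
Proof.
elim: m n => // m IHm n; rewrite addnS => nm_N; set s := map _ _.
have n_N : n < N by lia.
have s_sz : size s = n by rewrite size_map size_rev size_iota.
have revS : rev (iota 0 n.+1) = n :: rev (iota 0 n).
  by rewrite -addn1 iotaD rev_cat.
have room :
    map (make_room (rank n.+1 n)) s = [seq std n.+1 i | i <- rev (iota 0 n)].
  rewrite -map_comp; apply/eq_in_map => i; rewrite mem_rev mem_iota => /= i_n.
  exact: make_room_std.
apply: (@has_additionP _ _ (std n.+1 n)); rewrite ?room.
- rewrite s_sz /= /rank -addn1 iotaD count_cat /= ltnn !addn0.
  by apply: leq_trans (count_size _ _) _; rewrite size_iota.
- suff free k : k <= n ->
      no_violation (std n.+1 n) [seq std n.+1 i | i <- rev (iota 0 k)].
    exact: free.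
  elim: k => // k IHk k_n.
  rewrite -[k.+1]addn1 iotaD rev_cat /=.
  case: ifP => [|_]; last by apply: IHk; lia.
  rewrite has_map => /hasP[i]; rewrite mem_rev mem_iota /= => i_k.
  rewrite std_violation; try lia.
  by rewrite (negPf (p_free _ _ _)) //; lia.
- by have := IHm n.+1; rewrite revS addSn; apply.
Qed.

End Standardization.

Lemma violation_among_eight (p : nat -> spoint) :
  (forall i j, i < 8 -> j < 8 -> yrank (p i) = yrank (p j) -> i = j) ->
  exists i j k, [/\ i < j, j < k, k < 8 & violation (p i) (p j) (p k)].
Proof.
move=> yrank_inj.
have [/existsP[i /existsP[j /existsP[k /and3P[]]]]|no_vio] :=
  boolP [exists i : 'I_8, exists j : 'I_8, exists k : 'I_8,
         [&& i < j, j < k & violation (p i) (p j) (p k)]].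
  by exists i, j, k.
suff : extendable 7 [:: SPoint false false 0] by rewrite not_extendable.
have := @extendable_std p 8 yrank_inj _ 1 7 isT.
rewrite /= /std /rank /= ltnn !addbb; apply.
move=> i j k ij jk k8; apply: contra no_vio => vio.
have j8 := ltn_trans jk k8; have i8 := ltn_trans ij j8.
apply/existsP; exists (Ordinal i8); apply/existsP; exists (Ordinal j8).
by apply/existsP; exists (Ordinal k8); rewrite /= ij jk.
Qed.

(** * At most seven points in general position *)

Definition aligned (p m q : (nat * bool) * (nat * bool)) :=
  between p.1 m.1 q.1 && between p.2 m.2 q.2.

Definition spoint_of (p : (nat * bool) * (nat * bool)) :=
  SPoint p.1.2 (p.1.2 (+) p.2.2) p.2.1.

(** A transitive triangle has a middle vertex, and a monochromatic one has the
    same middle vertex in both coordinates. Listed by increasing first coordinate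
    modulo half a turn, the cyclic shift of q, m, p that follows the arrows
    depends on which of them is alone in its half-turn, if any. *)
Lemma violation_aligned q m p :
  q.1.1 < m.1.1 -> m.1.1 < p.1.1 ->
  q.2.1 != m.2.1 -> m.2.1 != p.2.1 -> q.2.1 != p.2.1 ->
  violation (spoint_of q) (spoint_of m) (spoint_of p) ->
  [|| aligned q m p, aligned m p q | aligned p q m].
Proof.
move=> qm mp qm2 mp2 qp2; have qp := ltn_trans qm mp.
rewrite /aligned /between.
rewrite (ahead_sym qm2) (ahead_sym mp2) (ahead_sym qp2).
rewrite (@ahead_sym q.1 m.1) ?(@ahead_sym m.1 p.1) ?(@ahead_sym q.1 p.1);
  try by rewrite neq_ltn ?qm ?mp ?qp.
rewrite /violation /agree /ahead /spoint_of /= qm mp qp.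
move: (q.1.2) (m.1.2) (p.1.2) (q.2.2) (m.2.2) (p.2.2).
move: (_ < _) (_ < _) (_ < _).
by do 9!case.
Qed.

Lemma gp_torus_le7 r s : 2 < r -> 2 < s -> gp_number (torus r s) <= 7.
Proof.
move=> r3 s3; apply/bigmax_leqP => S genS; rewrite leqNgt; apply/negP => S8.
(* Sorting by the first coordinate modulo half a turn makes the index, which is
   also the amount by which a point is moved, increase with that coordinate. *)
pose hx (u : 'I_r * 'I_s) := half r u.1.
pose l := sort (relpre hx leq) (enum S).
have size_l : size l = #|S| by rewrite size_sort -cardE.
have [u0 _] : exists u0, u0 \in S by apply/card_gt0P; apply: leq_trans S8.
pose pt i := nth u0 l i.
have pt_S i : i < 8 -> pt i \in S.
  move=> i8; rewrite -mem_enum -(mem_sort (relpre hx leq)) mem_nth //.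
  by rewrite size_l (leq_trans i8).
have pt_inj i j : i < 8 -> j < 8 -> i != j -> pt i != pt j.
  move=> i8 j8; rewrite nth_uniq ?size_l ?(leq_trans _ S8) //.
  by rewrite sort_uniq enum_uniq.
have hx_mono i j : i < 8 -> j < 8 -> i <= j -> hx (pt i) <= hx (pt j).
  move=> i8 j8; apply: (sorted_leq_nth (leT := relpre hx leq)).
  - by move=> ? ? ?; apply: leq_trans.
  - by move=> ?; apply: leqnn.
  - by apply: sort_sorted => ? ?; apply: leq_total.
  - by rewrite inE size_l (leq_trans i8).
  - by rewrite inE size_l (leq_trans j8).
pose z i := (spos r (pt i).1 i, spos s (pt i).2 i).
have zx_lt i j : i < j -> j < 8 -> (z i).1.1 < (z j).1.1.
  move=> ij j8; have := hx_mono i j (ltn_trans ij j8) j8 (ltnW ij).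
  by rewrite /hx /=; lia.
have zy_inj i j : i < 8 -> j < 8 -> (z i).2.1 = (z j).2.1 -> i = j.
  by move=> i8 j8 /spos_inj; apply.
have zy_ne i j : i < j -> j < 8 -> (z i).2.1 != (z j).2.1.
  move=> ij j8; apply/eqP => /zy_inj eq_ij.
  by move: (ij); rewrite eq_ij ?ltnn // (ltn_trans ij).
have not_aligned a b c : a < 8 -> b < 8 -> c < 8 ->
    a != b -> a != c -> b != c -> ~~ aligned (z a) (z b) (z c).
  move=> a8 b8 c8 ab ac bc; apply/negP => /andP[].
  move=> /between_cdist dx /between_cdist dy.
  move: genS => /'forall_implyP/(_ _ (pt_S a a8)).
  move=> /'forall_implyP/(_ _ (pt_S c c8))/'forall_implyP/(_ _ (pt_S b b8)).
  rewrite !pt_inj // 1?eq_sym //= !gdist_torus // dx // dy //.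
  by rewrite addnACA eqxx.
have [i [j [k [ij jk k8 vio]]]] :=
  @violation_among_eight (fun i => spoint_of (z i)) zy_inj.
have j8 := ltn_trans jk k8; have i8 := ltn_trans ij j8.
have ik := ltn_trans ij jk.
have ne a b : a < b -> (a != b) * (b != a) by move=> ab; split; lia.
have := violation_aligned (zx_lt i j ij j8) (zx_lt j k jk k8)
  (zy_ne i j ij j8) (zy_ne j k jk k8) (zy_ne i k ik k8) vio.
by case/or3P; apply/negP/not_aligned; rewrite ?(ne _ _ ij, ne _ _ jk, ne _ _ ik).
Qed.

Theorem theorem4p5 (r s : nat) (hrs : s <= r) (hs3 : 3 <= s) (hs4 : s <> 4)
    (hr6 : 6 <= r) :
  gp_number (cartesian_product (@cycle_graph r) (@cycle_graph s)) \in [:: 6; 7].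
Proof.
have le7 : gp_number (torus r s) <= 7.
  by apply: gp_torus_le7; rewrite // (leq_trans _ hr6).
have ge6 : 6 <= gp_number (torus r s).
  have [->|s5] : s = 3 \/ 5 <= s by lia.
    exact: six_le_gp_torus3.
  exact: six_le_gp_torus.
rewrite !inE; lia.
Qed.
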